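(* Let $\mathcal F$ be an arbitrary division ring and let $A\in\mathcal F^{m\times p}$, $B\in\mathcal F^{m\times q}$, $C\in\mathcal F^{s\times p}$, $D\in\mathcal F^{t\times p}$ be arbitrary matrices. Let $M,P,Q,S,T$ be invertible matrices over $\mathcal F$ (of sizes $m,p,q,s,t$ respectively) and let $r_8,\dots,r_{14}$ be nonnegative integers such that $$MAP=S_a,\quad MBQ=S_b,\quad SCP=S_c,\quad TDP=S_d,$$ where $S_a,S_b,S_c,S_d$ are the canonical block matrices described in the context, with block sizes given in terms of $r_1,\dots,r_7$ (defined in the context) and $r_8,\dots,r_{14}$. Then, writing $\mathrm{r}(\cdot)$ for the rank, $$r_{8}=-\mathrm{r}\begin{pmatrix}A\\ D\end{pmatrix}-\mathrm{r}\begin{pmatrix}A&B\\ C&0\end{pmatrix}+\mathrm{r}\begin{pmatrix}0&A&B\\ A&A&0\\ C&0&0\\ 0&D&0\end{pmatrix},$$ $$r_{9}=\mathrm{r}\begin{pmatrix}A&B\\ C&0\end{pmatrix}+\mathrm{r}\begin{pmatrix}A&B\\ D&0\end{pmatrix}-\mathrm{r}\begin{pmatrix}0&A&B\\ A&A&0\\ C&0&0\\ 0&D&0\end{pmatrix}+\mathrm{r}(A)-\mathrm{r}(A,\ B),$$ $$r_{10}=-\mathrm{r}(C)-\mathrm{r}\begin{pmatrix}A&B\\ D&0\end{pmatrix}+\mathrm{r}\begin{pmatrix}A&A&B\\ C&0&0\\ 0&D&0\end{pmatrix},$$ $$r_{11}=\mathrm{r}(C)+\mathrm{r}(D)+\mathrm{r}(A,\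 B)-\mathrm{r}\begin{pmatrix}A&A&B\\ C&0&0\\ 0&D&0\end{pmatrix},$$ $$r_{12}=\mathrm{r}\begin{pmatrix}A\\ C\end{pmatrix}+\mathrm{r}\begin{pmatrix}A\\ D\end{pmatrix}-\mathrm{r}\begin{pmatrix}A\\ C\\ D\end{pmatrix}+\mathrm{r}\begin{pmatrix}A&B\\ C&0\\ D&0\end{pmatrix}-\mathrm{r}\begin{pmatrix}0&A&B\\ A&A&0\\ C&0&0\\ 0&D&0\end{pmatrix},$$ $$r_{13}=\mathrm{r}\begin{pmatrix}A&B\\ C&0\end{pmatrix}+\mathrm{r}\begin{pmatrix}A&B\\ D&0\end{pmatrix}+\mathrm{r}\begin{pmatrix}A&A\\ C&0\\ 0&D\end{pmatrix}-\mathrm{r}\begin{pmatrix}A&A&B\\ C&0&0\\ 0&D&0\end{pmatrix}-\mathrm{r}\begin{pmatrix}0&A&B\\ A&A&0\\ C&0&0\\ 0&D&0\end{pmatrix},$$ $$r_{14}=\mathrm{r}\begin{pmatrix}C\\ D\end{pmatrix}-\mathrm{r}\begin{pmatrix}A&B\\ C&0\\ D&0\end{pmatrix}-\mathrm{r}\begin{pmatrix}A&A\\ C&0\\ 0&D\end{pmatrix}+\mathrm{r}\begin{pmatrix}0&A&B\\ A&A&0\\ C&0&0\\ 0&D&0\end{pmatrix}.$$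
   Context: $\mathcal F$ is an arbitrary division ring; $\mathcal F^{m\times n}$ is the set of $m\times n$ matrices over $\mathcal F$. The rank $\mathrm{r}(A)$ is the dimension of the left row space of $A$, which equals the dimension of its right column space. Blocks $0$ are zero blocks of the appropriate size; blocks with zero rows or columns are allowed. Definitions of $r_1,\dots,r_7$: $r_1=\mathrm{r}(A,B)-\mathrm{r}(B)$; $r_2=\mathrm{r}(A)+\mathrm{r}(B)-\mathrm{r}(A,B)$; $r_3=\mathrm{r}\begin{pmatrix}A\\ C\end{pmatrix}-\mathrm{r}(A)$; $r_4=\mathrm{r}\begin{pmatrix}A&B\\ C&0\end{pmatrix}+\mathrm{r}(A)-\mathrm{r}(A,B)-\mathrm{r}\begin{pmatrix}A\\ C\end{pmatrix}$; $r_5=\mathrm{r}(C)+\mathrm{r}(A,B)-\mathrm{r}\begin{pmatrix}A&B\\ C&0\end{pmatrix}$; $r_6=\mathrm{r}\begin{pmatrix}A\\ C\\ D\end{pmatrix}-\mathrm{r}\begin{pmatrix}A\\ C\end{pmatrix}$; $r_7=\mathrm{r}\begin{pmatrix}A\\ D\end{pmatrix}+\mathrm{r}\begin{pmatrix}A\\ C\end{pmatrix}-\mathrm{r}(A)-\mathrm{r}\begin{pmatrix}A\\ C\\ D\end{pmatrix}$. Also $r_\theta=r_1-r_5-r_{10}-r_{13}-r_{14}$ and $r_\pi=r_2-r_4-r_8-r_{12}$. All block sizes listed below are required to be nonnegative. Canonical block matrices: (1) $S_a=\begin{pmatrix}0&I&0\\ 0&0&0\\ I&0&0\\ 0&0&0\end{pmatrix}$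 with column block sizes $r_1,\ r_2,\ p-r_1-r_2$ and row block sizes $r_2,\ \mathrm{r}(B)-r_2,\ r_1,\ m-\mathrm{r}(B)-r_1$. (2) $S_b=\begin{pmatrix}I&0\\ 0&0\end{pmatrix}$ with $I$ of size $\mathrm{r}(B)$. (3) $S_c=\begin{pmatrix}I&0&0&0&0&0\\ 0&0&I&0&0&0\\ 0&0&0&0&I&0\\ 0&0&0&0&0&0\end{pmatrix}$ with column block sizes $r_5,\ r_1-r_5,\ r_4,\ r_2-r_4,\ r_3,\ p-r_1-r_2-r_3$ and row block sizes $r_5,r_4,r_3,s-r_3-r_4-r_5$. (4) $S_d$ is a $10\times 18$ block matrix. Its column block sizes are, in order, $r_{11}$, $r_5-r_{11}$, $r_{10}$, $r_{13}$, $r_{14}$, $r_\theta$, $r_{13}$, $r_9-r_{13}$, $r_4-r_9$, $r_8$, $r_{12}$, $r_\pi$, $r_{12}$, $r_{14}$, $r_7-r_{12}-r_{14}$, $r_3-r_7$, $r_6$, and the remaining columns. Its row block sizes are, in order, $r_{11}$, $r_{10}$, $r_{13}$, $r_9-r_{13}$, $r_{12}$, $r_{14}$, $r_7-r_{12}-r_{14}$, $r_8$, $r_6$, and the remaining rows. The blocks in (row, column) positions $(1,1)$, $(2,3)$, $(3,4)$, $(3,7)$, $(4,8)$, $(5,11)$, $(5,13)$, $(6,5)$, $(6,14)$, $(7,15)$, $(8,10)$, $(9,17)$ are identity matrices; all other blocks are zero. It is known from earlier work that for all matrices $A\in\mathcal F^{m\times p}$, $B\in\mathcal F^{m\times q}$,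 $C\in\mathcal F^{s\times p}$, $D\in\mathcal F^{t\times p}$ over an arbitrary division ring $\mathcal F$, there exist invertible matrices $M,P,Q,S,T$ over $\mathcal F$ (of sizes $m,p,q,s,t$ respectively) and nonnegative integers $r_8,\dots,r_{14}$ such that $MAP=S_a$, $MBQ=S_b$, $SCP=S_c$, $TDP=S_d$. *)

(* Defs.v *)
From mathcomp Require Import all_boot all_order all_algebra.
From mathcomp Require Import boolp classical_sets.

Set Implicit Arguments.
Unset Strict Implicit.
Unset Printing Implicit Defensive.

Import Order.TTheory GRing.Theory Num.Theory.
Local Open Scope ring_scope.

(* mathcomp has no structure of division rings: a division ring is a
   unitRingType (not necessarily commutative, 1 != 0) in which every nonzero
   element is a (two-sided) unit. *)
Definition division_ring (F : unitRingType) : Prop :=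
  forall x : F, x != 0 -> x \is a GRing.unit.

(* mxalgebra's \rank and matrix's unitmx require commutative scalars, hence the
   definitions of dimension, rank and invertibility below. *)

Definition lin_indep (F : unitRingType) (V : lmodType F) k (b : 'I_k -> V) :
    Prop :=
  forall c : 'I_k -> F, \sum_i c i *: b i = 0 -> forall i, c i = 0.

Definition lspan (F : unitRingType) (V : lmodType F) k (b : 'I_k -> V) :
    set V :=
  [set v | exists c : 'I_k -> F, v = \sum_i c i *: b i]%classic.

Definition is_basis (F : unitRingType) (V : lmodType F) (U : set V) k
    (b : 'I_k -> V) : Prop :=
  lin_indep b /\ lspan b = U.

(* The number of elements of a basis of U; the default value 0 is used only when
   U has no finite basis, which does not happen for subspaces of 'rV_n over a
   division ring. *)
Definition dimension (F : unitRingType) (V : lmodType F) (U : set V) : nat :=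
  xget 0%N [set k | exists b : 'I_k -> V, is_basis U b]%classic.

Definition left_row_space (F : unitRingType) m n (A : 'M[F]_(m, n)) :
    set 'rV[F]_n :=
  [set v | exists u : 'rV[F]_m, v = u *m A]%classic.

(* Integer valued, since ranks are subtracted from one another. *)
Definition rk (F : unitRingType) m n (A : 'M[F]_(m, n)) : int :=
  (dimension (left_row_space A))%:Z.

Definition invertible_mx (F : unitRingType) n (M : 'M[F]_n) : Prop :=
  exists N : 'M[F]_n, M *m N = 1%:M /\ N *m M = 1%:M.

Definition nonneg_sizes (ks : seq int) : bool := all (fun k => 0 <= k) ks.

(* The block matrix with row block sizes rs and column block sizes cs whose
   blocks at the (1-based) positions listed in ids are identity matrices and
   whose other blocks are zero.  It is meaningful when all sizes are nonnegative,
   rs and cs sum to m and n, and the blocks listed in ids are square. *)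
Definition block_id (F : unitRingType) m n (rs cs : seq int)
    (ids : seq (nat * nat)) : 'M[F]_(m, n) :=
  let rs' := [seq `|k|%N | k <- rs] in
  let cs' := [seq `|k|%N | k <- cs] in
  \matrix_(i < m, j < n)
    ((((reshape_index rs' i).+1, (reshape_index cs' j).+1) \in ids)
     && (reshape_offset rs' i == reshape_offset cs' j))%:R.

Definition isum (ks : seq int) : int := \sum_(k <- ks) k.

Definition r1 (F : unitRingType) m p q (A : 'M[F]_(m, p)) (B : 'M[F]_(m, q)) :
  int := rk (row_mx A B) - rk B.

Definition r2 (F : unitRingType) m p q (A : 'M[F]_(m, p)) (B : 'M[F]_(m, q)) :
  int := rk A + rk B - rk (row_mx A B).

Definition r3 (F : unitRingType) m p s (A : 'M[F]_(m, p)) (C : 'M[F]_(s, p)) :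
  int := rk (col_mx A C) - rk A.

Definition r4 (F : unitRingType) m p q s (A : 'M[F]_(m, p)) (B : 'M[F]_(m, q))
    (C : 'M[F]_(s, p)) : int :=
  rk (block_mx A B C 0) + rk A - rk (row_mx A B) - rk (col_mx A C).

Definition r5 (F : unitRingType) m p q s (A : 'M[F]_(m, p)) (B : 'M[F]_(m, q))
    (C : 'M[F]_(s, p)) : int :=
  rk C + rk (row_mx A B) - rk (block_mx A B C 0).

Definition r6 (F : unitRingType) m p s t (A : 'M[F]_(m, p)) (C : 'M[F]_(s, p))
    (D : 'M[F]_(t, p)) : int :=
  rk (col_mx A (col_mx C D)) - rk (col_mx A C).

Definition r7 (F : unitRingType) m p s t (A : 'M[F]_(m, p)) (C : 'M[F]_(s, p))
    (D : 'M[F]_(t, p)) : int :=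
  rk (col_mx A D) + rk (col_mx A C) - rk A - rk (col_mx A (col_mx C D)).

Definition Sa_rows (F : unitRingType) m p q (A : 'M[F]_(m, p))
    (B : 'M[F]_(m, q)) : seq int :=
  [:: r2 A B; rk B - r2 A B; r1 A B; m%:Z - rk B - r1 A B].

Definition Sa_cols (F : unitRingType) m p q (A : 'M[F]_(m, p))
    (B : 'M[F]_(m, q)) : seq int :=
  [:: r1 A B; r2 A B; p%:Z - r1 A B - r2 A B].

Definition Sa (F : unitRingType) m p q (A : 'M[F]_(m, p)) (B : 'M[F]_(m, q)) :
    'M[F]_(m, p) :=
  block_id F m p (Sa_rows A B) (Sa_cols A B) [:: (1, 2); (3, 1)]%N.

Definition Sb_rows (F : unitRingType) m q (B : 'M[F]_(m, q)) : seq int :=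
  [:: rk B; m%:Z - rk B].

Definition Sb_cols (F : unitRingType) m q (B : 'M[F]_(m, q)) : seq int :=
  [:: rk B; q%:Z - rk B].

Definition Sb (F : unitRingType) m q (B : 'M[F]_(m, q)) : 'M[F]_(m, q) :=
  block_id F m q (Sb_rows B) (Sb_cols B) [:: (1, 1)]%N.

Definition Sc_rows (F : unitRingType) m p q s (A : 'M[F]_(m, p))
    (B : 'M[F]_(m, q)) (C : 'M[F]_(s, p)) : seq int :=
  [:: r5 A B C; r4 A B C; r3 A C; s%:Z - r3 A C - r4 A B C - r5 A B C].

Definition Sc_cols (F : unitRingType) m p q s (A : 'M[F]_(m, p))
    (B : 'M[F]_(m, q)) (C : 'M[F]_(s, p)) : seq int :=
  [:: r5 A B C; r1 A B - r5 A B C; r4 A B C; r2 A B - r4 A B C; r3 A C;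
      p%:Z - r1 A B - r2 A B - r3 A C].

Definition Sc (F : unitRingType) m p q s (A : 'M[F]_(m, p)) (B : 'M[F]_(m, q))
    (C : 'M[F]_(s, p)) : 'M[F]_(s, p) :=
  block_id F s p (Sc_rows A B C) (Sc_cols A B C)
    [:: (1, 1); (2, 3); (3, 5)]%N.

Definition rtheta (F : unitRingType) m p q s (A : 'M[F]_(m, p))
    (B : 'M[F]_(m, q)) (C : 'M[F]_(s, p)) (r10 r13 r14 : nat) : int :=
  r1 A B - r5 A B C - r10%:Z - r13%:Z - r14%:Z.

Definition rpi (F : unitRingType) m p q s (A : 'M[F]_(m, p)) (B : 'M[F]_(m, q))
    (C : 'M[F]_(s, p)) (r8 r12 : nat) : int :=
  r2 A B - r4 A B C - r8%:Z - r12%:Z.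

Definition Sd_rows (F : unitRingType) m p s t (A : 'M[F]_(m, p))
    (C : 'M[F]_(s, p)) (D : 'M[F]_(t, p)) (r8 r9 r10 r11 r12 r13 r14 : nat) :
    seq int :=
  let ks := [:: r11%:Z; r10%:Z; r13%:Z; r9%:Z - r13%:Z; r12%:Z; r14%:Z;
                r7 A C D - r12%:Z - r14%:Z; r8%:Z; r6 A C D] in
  rcons ks (t%:Z - isum ks).

Definition Sd_cols (F : unitRingType) m p q s t (A : 'M[F]_(m, p))
    (B : 'M[F]_(m, q)) (C : 'M[F]_(s, p)) (D : 'M[F]_(t, p))
    (r8 r9 r10 r11 r12 r13 r14 : nat) : seq int :=
  let ks := [:: r11%:Z; r5 A B C - r11%:Z; r10%:Z; r13%:Z; r14%:Z;
                rtheta A B C r10 r13 r14; r13%:Z; r9%:Z - r13%:Z;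
                r4 A B C - r9%:Z; r8%:Z; r12%:Z; rpi A B C r8 r12; r12%:Z;
                r14%:Z; r7 A C D - r12%:Z - r14%:Z; r3 A C - r7 A C D;
                r6 A C D] in
  rcons ks (p%:Z - isum ks).

Definition Sd (F : unitRingType) m p q s t (A : 'M[F]_(m, p))
    (B : 'M[F]_(m, q)) (C : 'M[F]_(s, p)) (D : 'M[F]_(t, p))
    (r8 r9 r10 r11 r12 r13 r14 : nat) : 'M[F]_(t, p) :=
  block_id F t p (Sd_rows A C D r8 r9 r10 r11 r12 r13 r14)
    (Sd_cols A B C D r8 r9 r10 r11 r12 r13 r14)
    [:: (1, 1); (2, 3); (3, 4); (3, 7); (4, 8); (5, 11); (5, 13); (6, 5);
        (6, 14); (7, 15); (8, 10); (9, 17)]%N.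

(* Main.v *)
(* Equivalence of block matrices reduces every rank to that of a matrix assembled
   from the canonical forms.  Once the blocks of the four forms are subdivided
   compatibly, such a matrix is an integer matrix in which every nonzero entry
   stands for a multiple of an identity matrix, and Gaussian elimination with
   pivots 1 and -1 computes its rank: by Wedderburn's rank reduction, each pivot
   contributes the size of its block.  The formulas then follow by solving the
   resulting linear relations. *)
Require Import Defs.
From mathcomp Require Import all_boot all_order all_algebra.
From mathcomp Require Import boolp classical_sets zify.

Set Implicit Arguments.
Unset Strict Implicit.
Unset Printing Implicit Defensive.

Import Order.TTheory GRing.Theory Num.Theory.
Local Open Scope ring_scope.

(** * Positions in concatenated and subdivided lists of block sizes *)

Section ReshapeIndex.

Local Open Scope nat_scope.

Lemma reshape_index_cons n sh i :
  reshape_index (n :: sh) i =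
  if i < n then 0 else (reshape_index sh (i - n)).+1.
Proof.
by rewrite /reshape_index /= subn_eq0; case: ltnP => // le; rewrite subSn.
Qed.

Lemma reshape_offset_cons n sh i :
  reshape_offset (n :: sh) i = if i < n then i else reshape_offset sh (i - n).
Proof.
rewrite /reshape_offset reshape_index_cons; case: ltnP => _ /=.
  by rewrite subn0.
by rewrite subnDA.
Qed.

Lemma reshape_index_cat sh1 sh2 i :
  reshape_index (sh1 ++ sh2) i =
  if i < sumn sh1 then reshape_index sh1 i
  else size sh1 + reshape_index sh2 (i - sumn sh1).
Proof.
elim: sh1 i => [|n sh1 IH] i /=; first by rewrite subn0.
rewrite !reshape_index_cons IH; case: ltnP => [lt_in|le_ni].
  by rewrite ltn_addr.
by rewrite ltn_subLR // subnDA; case: ifP.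
Qed.

Lemma reshape_offset_cat sh1 sh2 i :
  reshape_offset (sh1 ++ sh2) i =
  if i < sumn sh1 then reshape_offset sh1 i
  else reshape_offset sh2 (i - sumn sh1).
Proof.
elim: sh1 i => [|n sh1 IH] i /=; first by rewrite subn0.
rewrite !reshape_offset_cons IH; case: ltnP => [lt_in|le_ni].
  by rewrite ltn_addr.
by rewrite ltn_subLR // subnDA.
Qed.

(** Locating a position in the coarse list and then inside its group gives its place in the
    subdivided list. *)
Lemma reshape_flatten gs i (I := reshape_index (map sumn gs) i)
    (O := reshape_offset (map sumn gs) i) :
  i < sumn (map sumn gs) ->
  reshape_index (flatten gs) i =
    flatten_index (shape gs) I (reshape_index (nth [::] gs I) O) /\
  reshape_offset (flatten gs) i = reshape_offset (nth [::] gs I) O.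
Proof.
rewrite {}/I {}/O; elim: gs i => //= g gs IH i lt_i.
rewrite reshape_index_cat reshape_offset_cat reshape_index_cons.
rewrite reshape_offset_cons; case: ltnP => //= le_i.
have [|-> ->] := IH (i - sumn g); first by rewrite ltn_subLR.
by rewrite /flatten_index /= addnA.
Qed.

Lemma reshape_inj sh i j :
  reshape_index sh i = reshape_index sh j ->
  reshape_offset sh i = reshape_offset sh j -> i = j.
Proof.
by move=> eqI eqO; rewrite -(reshape_indexK sh i) eqI eqO reshape_indexK.
Qed.

End ReshapeIndex.

(** * Rank over a division ring through full-rank factorizations *)

(** One-sided inverses certify rank [r] by matrix identities alone, without any commutativity. *)
Definition rank_factors (F : unitRingType) r m n (N : 'M[F]_(m, n)) : Prop :=
  exists (L : 'M[F]_(m, r)) (L' : 'M[F]_(r, m)) (R : 'M[F]_(r, n))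
         (R' : 'M[F]_(n, r)),
    [/\ N = L *m R, L' *m L = 1%:M & R *m R' = 1%:M].

Section RankFactors.

Variable F : unitRingType.

(** Elimination by induction on the columns: a zero first column is dropped; otherwise a nonzero
    entry [d] clears it and its row is removed. Rows are scaled from the left, so the order of
    factors in [X1] matters. *)
Lemma nonzero_left_kernel (divF : division_ring F) n m (X : 'M[F]_(m, n)) :
  (n < m)%N -> exists2 u : 'rV[F]_m, u != 0 & u *m X = 0.
Proof.
elim: n m X => [|n IHn] [|m] // X; first move=> _.
  exists (const_mx 1); last by apply/matrixP => ? [].
  by apply/eqP => /matrixP/(_ ord0 ord0)/eqP; rewrite !mxE oner_eq0.
rewrite ltnS => lt_nm.
have [/forallP X0 | /forallPn[i0 d_neq0]] :=
  boolP [forall i, X i (0 : 'I_n.+1) == 0].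
  have [u u_neq0 uX] := IHn _ (col' 0 X) (leqW lt_nm); exists u => //.
  apply/rowP => j; rewrite !mxE; have [k ->|->] := unliftP 0 j.
    move/rowP/(_ k): uX; rewrite !mxE; apply: etrans.
    by apply: eq_bigr => i _; rewrite mxE.
  by rewrite big1 // => i _; rewrite (eqP (X0 i)) mulr0.
set d := X i0 0 in d_neq0; have dU := divF _ d_neq0.
pose X1 := \matrix_(i, j) (X i j - X i 0 * d^-1 * X i0 j).
have [w w_neq0 wX] := IHn _ (row' i0 (col' 0 X1)) lt_nm.
(* The weight of row [i0] is forced by column 0, whose combination must vanish while
   [X i0 0 = d]. *)
pose e := - \sum_i w 0 i * X (lift i0 i) 0 * d^-1.
exists (\row_i oapp (w 0) e (unlift i0 i)).
  apply: contraNneq w_neq0 => /rowP u0; apply/eqP/rowP => i.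
  by have := u0 (lift i0 i); rewrite !mxE liftK.
apply/rowP => j; rewrite !mxE (bigD1_ord i0) //= mxE unlift_none /= /e.
rewrite mulNr mulr_suml addrC -sumrB.
under eq_bigr => i _ do rewrite mxE liftK /= -!mulrA -mulrBr mulrA.
have [k ->|->] := unliftP 0 j.
  move/rowP/(_ k): wX; rewrite !mxE; apply: etrans.
  by apply: eq_bigr => i _; rewrite !mxE.
by rewrite big1 // => i _; rewrite -/d divrK // subrr mulr0.
Qed.

Lemma right_invertible_leq (divF : division_ring F) m n (X : 'M[F]_(m, n)) Y :
  X *m Y = 1%:M -> (m <= n)%N.
Proof.
move=> XY; rewrite leqNgt; apply/negP => /(nonzero_left_kernel divF X)[u].
move=> /eqP u_neq0 uX; apply: u_neq0.
by rewrite -(mulmx1 u) -XY mulmxA uX mul0mx.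
Qed.

Lemma lspan_coords n k l (b : 'I_k -> 'rV[F]_n) (c : 'I_l -> 'rV[F]_n) :
  lspan c = lspan b ->
  exists X : 'M[F]_(l, k), forall i, c i = \sum_j X i j *: b j.
Proof.
move=> cb; have c_b i : exists f : 'I_k -> F, c i = \sum_j f j *: b j.
  have : lspan c (c i); last by rewrite cb.
  exists (fun j => (j == i)%:R).
  rewrite (bigD1 i) //= eqxx scale1r big1 ?addr0 // => j /negPf ->.
  by rewrite scale0r.
have [f fP] := choice c_b.
exists (\matrix_(i, j) f i j) => i; rewrite fP.
by apply: eq_bigr => j _; rewrite mxE.
Qed.

(** Expressing each family in the other gives coordinate matrices with [X *m Y = 1] by independence
    of [c], which bounds the rows of [X] by its columns. *)
Lemma lin_indep_leq (divF : division_ring F) n k l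
    (b : 'I_k -> 'rV[F]_n) (c : 'I_l -> 'rV[F]_n) :
  lin_indep c -> lspan c = lspan b -> (l <= k)%N.
Proof.
move=> c_free cb.
have [X XP] := @lspan_coords _ _ _ b c cb.
have [Y YP] := @lspan_coords _ _ _ c b (esym cb).
apply: (@right_invertible_leq divF _ _ X Y); apply/matrixP => i j.
apply/eqP; rewrite -subr_eq0; apply/eqP.
apply: (c_free (fun h => (X *m Y) i h - 1%:M i h)).
under eq_bigr => h _ do rewrite scalerBl mxE scaler_suml.
rewrite sumrB exchange_big /= [X in _ - X](bigD1 i) //= mxE eqxx scale1r.
rewrite [X in _ - (_ + X)]big1 ?addr0 => [|h /negPf ne]; last first.
  by rewrite mxE eq_sym ne scale0r.
apply/eqP; rewrite subr_eq0 [eqbRHS]XP; apply/eqP; apply: eq_bigr => h _.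
by rewrite YP scaler_sumr; apply: eq_bigr => g _; rewrite scalerA.
Qed.

Lemma dimension_basis (divF : division_ring F) n (U : set 'rV[F]_n) k
    (b : 'I_k -> 'rV[F]_n) :
  is_basis U b -> dimension U = k.
Proof.
move=> [b_free bU]; apply: xget_unique; first by exists b.
move=> l [c [c_free cU]]; apply/eqP; rewrite eqn_leq.
rewrite (lin_indep_leq divF c_free (etrans cU (esym bU))).
exact: (lin_indep_leq divF b_free (etrans bU (esym cU))).
Qed.

(** The rows of [R] form a basis of the row space: [R'] gives independence, and [L'] turns their
    combinations into combinations of rows of [N]. *)
Lemma rk_rank_factors (divF : division_ring F) r m n (N : 'M[F]_(m, n)) :
  rank_factors r N -> rk N = r%:Z.
Proof.
move=> [L [L' [R [R' [-> L'L RR']]]]]; congr Posz.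
have rowsR (c : 'I_r -> F) : \sum_i c i *: row i R = (\row_i c i) *m R.
  by rewrite mulmx_sum_row; apply: eq_bigr => i _; rewrite mxE.
apply: (@dimension_basis divF _ _ _ (fun i => row i R)); split.
  move=> c; rewrite rowsR => /(congr1 (mulmx^~ R')).
  by rewrite -mulmxA RR' mulmx1 mul0mx => /rowP c0 i; have := c0 i; rewrite !mxE.
apply/seteqP; split=> v /=.
  move=> [c ->]; exists ((\row_i c i) *m L').
  by rewrite rowsR mulmxA -[_ *m L' *m L]mulmxA L'L mulmx1.
move=> [u ->]; exists (fun i => (u *m L) 0 i).
rewrite rowsR mulmxA; congr (_ *m _).
by apply/rowP => i; rewrite [RHS]mxE.
Qed.

Lemma rank_factors0 m n : rank_factors 0 (0 : 'M[F]_(m, n)).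
Proof.
exists 0, 0, 0, 0; split; first by rewrite mulmx0.
- by apply/matrixP => -[].
- by apply/matrixP => -[].
Qed.

Lemma rank_factors_equiv r m n (U : 'M[F]_m) (V : 'M[F]_n) N :
  invertible_mx U -> invertible_mx V ->
  rank_factors r (U *m N *m V) -> rank_factors r N.
Proof.
move=> [U1 [UU1 U1U]] [V1 [VV1 V1V]] [L [L' [R [R' [eqN L'L RR']]]]].
exists (U1 *m L), (L' *m U), (R *m V1), (V *m R'); split.
- by rewrite -mulmxA [L *m _]mulmxA -eqN -!mulmxA VV1 mulmx1 mulmxA U1U mul1mx.
- by rewrite -mulmxA [U *m _]mulmxA UU1 mul1mx.
- by rewrite -mulmxA [V1 *m _]mulmxA V1V mul1mx.
Qed.

(** Wedderburn's rank reduction. [V] annihilates the residue on the left and [U] on the right, hence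
    [V *m L = 0] and [R *m U = 0]. Bordering [L] by [N *m U] and [R] by [V *m N] then factors
    [N]. *)
Lemma rank_factors_pivot r k m n (N : 'M[F]_(m, n)) (U : 'M_(n, k))
    (V : 'M_(k, m)) :
  V *m N *m U = 1%:M -> rank_factors r (N - N *m U *m V *m N) ->
  rank_factors (k + r) N.
Proof.
move=> VNU [L [L' [R [R' [eqN L'L RR']]]]].
have VL : V *m L = 0.
  rewrite -[L]mulmx1 -RR' [L *m _]mulmxA -eqN !mulmxA mulmxBr !mulmxA VNU.
  by rewrite mul1mx subrr mul0mx.
have RU : R *m U = 0.
  rewrite -[R]mul1mx -L'L -[L' *m L *m R]mulmxA -eqN -mulmxA mulmxBl.
  by rewrite -!mulmxA [V *m _]mulmxA VNU mulmx1 subrr mulmx0.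
exists (row_mx (N *m U) L), (col_mx V (L' *m (1%:M - N *m U *m V))).
exists (col_mx (V *m N) R), (row_mx U ((1%:M - U *m V *m N) *m R')); split.
- by rewrite mul_row_col -eqN !mulmxA addrC subrK.
- rewrite mul_col_row mulmxA VNU VL -!mulmxA !mulmxBl !mul1mx -!mulmxA VL.
  rewrite [V *m _]mulmxA VNU !mulmx0 subr0 L'L mulmx1 subrr mulmx0.
  by rewrite -scalar_mx_block.
- rewrite mul_col_row VNU RU !mulmxA !mulmxBr !mulmx1 !mulmxA VNU RU.
  by rewrite mul1mx subrr !mul0mx subr0 RR' -scalar_mx_block.
Qed.

End RankFactors.

(** * Integer patterns of block matrices and their elimination *)

(** Integer entries make the elimination independent of [F]: their images are central, and 1 and -1
    are units in every characteristic. *)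
Definition pattern := nat -> nat -> int.

(* Evaluates E once on r x c entries: without it, each step of [eliminate] would
   reevaluate all the previous ones. *)
Definition tabulate (r c : nat) (E : pattern) : pattern :=
  let t := [seq [seq E i j | j <- iota 0 c] | i <- iota 0 r] in
  fun i j => nth 0 (nth [::] t i) j.

(* rl and cl label the row and column blocks by their sizes, and E i j is the
   multiple of the identity in block (i, j).  The result lists the labels of the
   pivots; None means that a pivot is not 1 or -1, that the labels of its row or
   of a nonzero entry of its column disagree, or that fuel has run out. *)
Fixpoint eliminate fuel (rl cl : seq nat) (E : pattern) : option (seq nat) :=
  let rows := iota 0 (size rl) in
  let cols := iota 0 (size cl) in
  match [seq ab <- [seq (a, b) | a <- rows, b <- cols] | E ab.1 ab.2 != 0] with
  | [::] => Some [::]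
  | (a, b) :: _ =>
    let l := nth 0%N rl a in
    let ok := [&& E a b * E a b == 1, nth 0%N cl b == l &
                  all (fun i => (E i b == 0) || (nth 0%N rl i == l)) rows] in
    let E' := tabulate (size rl) (size cl)
                (fun i j => E i j - E a b * E i b * E a j) in
    if fuel is k.+1 then
      if ok then omap (cons l) (eliminate k rl cl E') else None
    else None
  end.

(** Each group of [gs] or [hs] lists the parts of one coarse block. An identity block cut alike on
    both sides becomes identities on its diagonal parts, whence the equality of offsets; the
    successors match the 1-based [ids]. *)
Definition refine_pattern (gs hs : seq (seq nat)) (ids : seq (nat * nat)) :
    pattern := fun i j =>
  ((((reshape_index (shape gs) i).+1, (reshape_index (shape hs) j).+1) \in ids)
     && (reshape_offset (shape gs) i == reshape_offset (shape hs) j))%:R.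

Definition row_pattern k (E1 E2 : pattern) : pattern :=
  fun i j => if (j < k)%N then E1 i j else E2 i (j - k)%N.

Definition col_pattern k (E1 E2 : pattern) : pattern :=
  fun i j => if (i < k)%N then E1 i j else E2 (i - k)%N j.

(** * Matrices over [F] described by patterns *)

Section PatternMatrix.

Variables (F : unitRingType) (sz : nat -> nat).

Definition pattern_mx m n (rl cl : seq nat) (E : pattern) : 'M[F]_(m, n) :=
  let rs := map sz rl in
  let cs := map sz cl in
  \matrix_(i < m, j < n)
    ((E (reshape_index rs i) (reshape_index cs j))%:~R *+
     (reshape_offset rs i == reshape_offset cs j)).

Lemma eq_pattern_mx m n rl cl E E' :
  m = sumn (map sz rl) -> n = sumn (map sz cl) ->
  (forall i j, (i < size rl)%N -> (j < size cl)%N -> E i j = E' i j) ->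
  pattern_mx m n rl cl E = pattern_mx m n rl cl E'.
Proof.
move=> em en eqE; subst m n; apply/matrixP => i j; rewrite !mxE eqE //.
  by rewrite -(size_map sz) reshape_indexP.
by rewrite -(size_map sz) reshape_indexP.
Qed.

Lemma pattern_mx0 m n rl cl : pattern_mx m n rl cl (fun _ _ => 0) = 0.
Proof. by apply/matrixP => i j; rewrite !mxE mul0rn. Qed.

Lemma tabulateE r c E i j : (i < r)%N -> (j < c)%N -> tabulate r c E i j = E i j.
Proof.
move=> lt_ir lt_jc; rewrite /tabulate (nth_map 0%N) ?size_iota //.
by rewrite (nth_map 0%N) ?size_iota // !nth_iota.
Qed.

(** Each step is an instance of [rank_factors_pivot] in which [U] and [V] select the columns and
    rows of the pivot block. *)
Lemma rank_factors_eliminate fuel m n rl cl E ls :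
  m = sumn (map sz rl) -> n = sumn (map sz cl) ->
  eliminate fuel rl cl E = Some ls ->
  rank_factors (sumn (map sz ls)) (pattern_mx m n rl cl E).
Proof.
move=> em en; elim: fuel E ls => [|fuel IH] E ls /=.
all: set s := [seq ab <- _ | _]; case def_s: s => [|[a b] s'] //.
1,2: case=> <-; rewrite (@eq_pattern_mx _ _ _ _ _ (fun _ _ => 0)) //
       ?pattern_mx0; [exact: rank_factors0|move=> i j lt_i lt_j; apply/eqP].
1,2: suff: ~~ ((i, j) \in s);
       first by rewrite mem_filter allpairs_f ?mem_iota // andbT negbK.
1,2: by rewrite def_s.
case: ifP => // /and3P[/eqP Eab2 /eqP cl_b /allP col_b].
case def_ls: eliminate => [ls'|] //= [<-] /=.
set N := pattern_mx _ _ _ _ _.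
have : (a, b) \in s by rewrite def_s mem_head.
rewrite mem_filter => /andP[_ /allpairsP[[a' b'] [/= + + [ea eb]]]].
subst a' b'; rewrite !mem_iota /= => lt_a lt_b.
set l := nth 0%N rl a in cl_b col_b *.
have nrl: nth 0%N (map sz rl) a = sz l by rewrite (nth_map 0%N).
have ncl: nth 0%N (map sz cl) b = sz l by rewrite (nth_map 0%N) // cl_b.
have f_lt (x : 'I_(sz l)) : (flatten_index (map sz rl) a x < m)%N.
  by rewrite em flatten_indexP // nrl.
have g_lt (x : 'I_(sz l)) : (flatten_index (map sz cl) b x < n)%N.
  by rewrite en flatten_indexP // ncl.
pose f x := Ordinal (f_lt x); pose g x := Ordinal (g_lt x).
have NU : N *m colsub g 1%:M = colsub g N by rewrite mulmx_colsub mulmx1.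
have VN : rowsub f 1%:M *m N = rowsub f N by rewrite mul_rowsub_mx mul1mx.
(* The pivot has square 1, so scaling by [E a b] inverts it. *)
apply: (@rank_factors_pivot _ _ _ _ _ _ (colsub g 1%:M)
          ((E a b)%:~R *: rowsub f 1%:M)).
  rewrite -!scalemxAl VN mul_rowsub_mx NU; apply/matrixP => x y; rewrite !mxE /=.
  rewrite !flatten_indexKl ?flatten_indexKr ?nrl ?ncl //.
  by rewrite mulrnAr -intrM Eab2.
rewrite (_ : N - _ = pattern_mx m n rl cl (tabulate (size rl) (size cl)
  (fun i j => E i j - E a b * E i b * E a j))); first exact: IH.
rewrite (eq_pattern_mx em en (@tabulateE _ _ _)) NU -mulmxA -scalemxAl VN.
apply/matrixP => i j; rewrite !mxE.
set oi := reshape_offset _ i; set oj := reshape_offset _ j.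
set ai := reshape_index _ i; set bj := reshape_index _ j.
under eq_bigr => x _.
  rewrite !mxE /= !flatten_indexKl ?flatten_indexKr ?nrl ?ncl //.
  rewrite -/oi -/oj -/ai -/bj.
  over.
have [Eib|Eib] := eqVneq (E ai b) 0.
  rewrite Eib mulr0 mul0r subr0 big1 ?subr0 // => x _.
  by rewrite mul0rn mul0r.
(* A nonzero entry in the pivot column forces row block [ai] to have label [l], so [oi] is a valid
   index in the pivot block and only its term of the sum survives. *)
have lt_ai : (ai < size rl)%N by rewrite -(size_map sz) reshape_indexP -?em.
have lt_oi : (oi < sz l)%N.
  have := col_b ai; rewrite mem_iota lt_ai (negPf Eib) => /(_ isT)/eqP <-.
  by rewrite -(nth_map _ 0%N) // reshape_offsetP -?em.
rewrite (bigD1 (Ordinal lt_oi)) //= eqxx big1 ?addr0 => [|x]; last first.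
  by rewrite -val_eqE /= eq_sym => /negPf ->; rewrite mul0r.
by rewrite !mulrnAr -mulrnBl -!intrM -intrB mulrCA mulrA.
Qed.

(** Identity blocks are cut alike in rows and columns, so they split into smaller identities; zero
    blocks stay zero under any cut. *)
Lemma block_id_pattern_mx m n (rs cs : seq int) (gs hs : seq (seq nat)) ids :
  m = sumn (map sz (flatten gs)) -> n = sumn (map sz (flatten hs)) ->
  [seq `|k|%N | k <- rs] = [seq sumn (map sz g) | g <- gs] ->
  [seq `|k|%N | k <- cs] = [seq sumn (map sz h) | h <- hs] ->
  all (fun ab => nth [::] gs ab.1.-1 == nth [::] hs ab.2.-1) ids ->
  block_id F m n rs cs ids =
  pattern_mx m n (flatten gs) (flatten hs) (refine_pattern gs hs ids).
Proof.
rewrite /block_id /pattern_mx !map_flatten => em en -> -> /allP ids_ok.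
set gs' := map (map sz) gs in em *; set hs' := map (map sz) hs in en *.
have -> : [seq sumn (map sz g) | g <- gs] = map sumn gs' by rewrite -map_comp.
have -> : [seq sumn (map sz g) | g <- hs] = map sumn hs' by rewrite -map_comp.
rewrite sumn_flatten in em; rewrite sumn_flatten in en.
apply/matrixP => i j; rewrite !mxE.
have lt_i : (i < sumn (map sumn gs'))%N by rewrite -em.
have lt_j : (j < sumn (map sumn hs'))%N by rewrite -en.
have [-> ->] := reshape_flatten lt_i; have [-> ->] := reshape_flatten lt_j.
have := reshape_offsetP lt_i; have := reshape_offsetP lt_j.
have := reshape_indexP lt_i; have := reshape_indexP lt_j.
set I := reshape_index _ i; set J := reshape_index _ j.
set oi := reshape_offset _ i; set oj := reshape_offset _ j.
rewrite !size_map => lt_J lt_I.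
rewrite !(nth_map [::]) ?size_map // -!(nth_map _ [::]) // -/gs' -/hs'.
move=> lt_oj lt_oi.
have shape_map (ks : seq (seq nat)) : shape ks = shape (map (map sz) ks).
  by rewrite /shape -map_comp; apply: eq_map => k /=; rewrite size_map.
rewrite /refine_pattern (shape_map gs) (shape_map hs) -/gs' -/hs'.
have nth_shape (ks : seq (seq nat)) k :
    nth 0%N (shape ks) k = size (nth [::] ks k).
  by elim: ks k => [|h ks IH] [|k] //=.
have := reshape_indexP lt_oi; rewrite -nth_shape => lt_ri.
have := reshape_indexP lt_oj; rewrite -nth_shape => lt_rj.
rewrite !flatten_indexKl // !flatten_indexKr //.
case: (boolP (_ \in ids)) => [/ids_ok/eqP /= eq_IJ|_]; last by rewrite mul0rn.
have -> : nth [::] hs' J = nth [::] gs' I by rewrite !(nth_map [::]) // eq_IJ.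
set g := nth [::] gs' I.
(* Within a common subdivision, equal positions mean the same part and the same offset in it. *)
have -> : (oi == oj) = (reshape_index g oi == reshape_index g oj) &&
                       (reshape_offset g oi == reshape_offset g oj).
  apply/eqP/andP => [->//|[/eqP eqI /eqP eqO]]; exact: reshape_inj eqO.
by case: eqP; case: eqP.
Qed.

Lemma row_mx_pattern_mx m n1 n2 rl cl1 cl2 E1 E2 :
  n1 = sumn (map sz cl1) ->
  row_mx (pattern_mx m n1 rl cl1 E1) (pattern_mx m n2 rl cl2 E2) =
  pattern_mx m (n1 + n2) rl (cl1 ++ cl2) (row_pattern (size cl1) E1 E2).
Proof.
move=> e1; apply/matrixP => i j; rewrite !mxE map_cat.
rewrite reshape_index_cat reshape_offset_cat /row_pattern size_map -e1.
case: splitP => k ->; rewrite mxE.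
  by rewrite -(size_map sz cl1) reshape_indexP -?e1.
by rewrite ltnNge leq_addr /= !addKn.
Qed.

Lemma col_mx_pattern_mx m1 m2 n rl1 rl2 cl E1 E2 :
  m1 = sumn (map sz rl1) ->
  col_mx (pattern_mx m1 n rl1 cl E1) (pattern_mx m2 n rl2 cl E2) =
  pattern_mx (m1 + m2) n (rl1 ++ rl2) cl (col_pattern (size rl1) E1 E2).
Proof.
move=> e1; apply/matrixP => i j; rewrite !mxE map_cat.
rewrite reshape_index_cat reshape_offset_cat /col_pattern size_map -e1.
case: splitP => k ->; rewrite mxE.
  by rewrite -(size_map sz rl1) reshape_indexP -?e1.
by rewrite ltnNge leq_addr /= !addKn.
Qed.

(** * Reduction of assembled block matrices to patterns *)

(** [U] and [V] are explicit so that blocks in one block row can share [U], and blocks in one block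
    column can share [V]. *)
Definition reduces m n (U : 'M[F]_m) (V : 'M[F]_n) (N : 'M[F]_(m, n))
    rl cl (E : pattern) : Prop :=
  [/\ invertible_mx U /\ m = sumn (map sz rl),
      invertible_mx V /\ n = sumn (map sz cl) &
      U *m N *m V = pattern_mx m n rl cl E].

Lemma invertible_diag_mx m n (U : 'M[F]_m) (V : 'M[F]_n) :
  invertible_mx U -> invertible_mx V -> invertible_mx (block_mx U 0 0 V).
Proof.
move=> [U1 [UU1 U1U]] [V1 [VV1 V1V]]; exists (block_mx U1 0 0 V1).
rewrite !mulmx_block UU1 U1U VV1 V1V !mulmx0 !mul0mx !addr0 !add0r.
by rewrite -scalar_mx_block.
Qed.

Lemma reduces_row m n1 n2 (U : 'M[F]_m) (V1 : 'M_n1) (V2 : 'M_n2)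
    N1 N2 rl cl1 cl2 E1 E2 :
  reduces U V1 N1 rl cl1 E1 -> reduces U V2 N2 rl cl2 E2 ->
  reduces U (block_mx V1 0 0 V2) (row_mx N1 N2) rl (cl1 ++ cl2)
    (row_pattern (size cl1) E1 E2).
Proof.
move=> [Uok [V1inv en1] eqN1] [_ [V2inv en2] eqN2]; split=> //.
  by split; [exact: invertible_diag_mx|rewrite map_cat sumn_cat -en1 -en2].
rewrite mul_mx_row mul_row_block !mulmx0 addr0 add0r eqN1 eqN2.
exact: row_mx_pattern_mx.
Qed.

Lemma reduces_col m1 m2 n (U1 : 'M[F]_m1) (U2 : 'M_m2) (V : 'M_n)
    N1 N2 rl1 rl2 cl E1 E2 :
  reduces U1 V N1 rl1 cl E1 -> reduces U2 V N2 rl2 cl E2 ->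
  reduces (block_mx U1 0 0 U2) V (col_mx N1 N2) (rl1 ++ rl2) cl
    (col_pattern (size rl1) E1 E2).
Proof.
move=> [[U1inv em1] Vok eqN1] [[U2inv em2] _ eqN2]; split=> //.
  by split; [exact: invertible_diag_mx|rewrite map_cat sumn_cat -em1 -em2].
rewrite mul_block_col !mul0mx addr0 add0r mul_col_mx eqN1 eqN2.
exact: col_mx_pattern_mx.
Qed.

(** A zero block takes its row transformation from one neighbour and its column transformation from
    another. *)
Lemma reduces0 m1 m2 n1 n2 (U1 : 'M[F]_m1) (U2 : 'M_m2) (V1 : 'M_n1)
    (V2 : 'M_n2) N1 N2 rl1 rl2 cl1 cl2 E1 E2 :
  reduces U1 V1 N1 rl1 cl1 E1 -> reduces U2 V2 N2 rl2 cl2 E2 ->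
  reduces U1 V2 (0 : 'M_(m1, n2)) rl1 cl2 (fun _ _ => 0).
Proof.
by move=> [? _ _] [_ ? _]; split; rewrite // mulmx0 mul0mx pattern_mx0.
Qed.

Lemma rk_reduces (divF : division_ring F) fuel m n (U : 'M[F]_m) (V : 'M_n)
    N rl cl E ls :
  reduces U V N rl cl E -> eliminate fuel rl cl E = Some ls ->
  rk N = (sumn (map sz ls))%:Z.
Proof.
move=> [[Uinv em] [Vinv en] eqN] El.
apply/rk_rank_factors/(rank_factors_equiv Uinv Vinv) => //.
by rewrite eqN; apply: rank_factors_eliminate El.
Qed.

End PatternMatrix.

(** * Common subdivision of the four canonical forms *)

(* A block size is represented by a label: label l <= 18 stands for the l-th
   column block size of S_d, except that the blocks 7, 13, 14 carry the labels
   4, 11, 5 of the blocks 4, 11, 5 of the same size; labels 19 to 23 stand for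
   the remaining sizes of S_a, S_b, S_c and S_d.  The blocks of S_a, S_b, S_c are
   subdivided accordingly. *)
Definition A_rows := [:: [:: 4; 8; 9; 10; 11; 12]; [:: 19]; iota 1 6; [:: 20]]%N.
Definition A_cols :=
  [:: iota 1 6; [:: 4; 8; 9; 10; 11; 12]; [:: 11; 5; 15; 16; 17; 18]]%N.
Definition B_rows := [:: [:: 4; 8; 9; 10; 11; 12; 19]; iota 1 6 ++ [:: 20]]%N.
Definition B_cols := [:: [:: 4; 8; 9; 10; 11; 12; 19]; [:: 21]]%N.
Definition C_rows :=
  [:: [:: 1; 2]; [:: 4; 8; 9]; [:: 11; 5; 15; 16]; [:: 22]]%N.
Definition C_cols :=
  [:: [:: 1; 2]; [:: 3; 4; 5; 6]; [:: 4; 8; 9]; [:: 10; 11; 12];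
      [:: 11; 5; 15; 16]; [:: 17; 18]]%N.
Definition D_rows :=
  [seq [:: l] | l <- [:: 1; 3; 4; 8; 11; 5; 15; 10; 17; 23]]%N.
Definition D_cols :=
  [seq [:: l] |
   l <- [:: 1; 2; 3; 4; 5; 6; 4; 8; 9; 10; 11; 12; 11; 5; 15; 16; 17; 18]]%N.

(** The leading 0 fills index 0, as labels start at 1. *)
Definition label_size (F : unitRingType) m p q s t (A : 'M[F]_(m, p))
    (B : 'M[F]_(m, q)) (C : 'M[F]_(s, p)) (D : 'M[F]_(t, p))
    (r8 r9 r10 r11 r12 r13 r14 : nat) : nat -> nat :=
  nth 0%N (0%N :: [seq `|k|%N |
    k <- Sd_cols A B C D r8 r9 r10 r11 r12 r13 r14 ++
         [:: rk B - r2 A B; m%:Z - rk B - r1 A B; q%:Z - rk B;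
             s%:Z - r3 A C - r4 A B C - r5 A B C;
             last 0 (Sd_rows A C D r8 r9 r10 r11 r12 r13 r14)]]).

Ltac label_lia :=
  rewrite /label_size /Sd_cols /Sd_rows /isum !big_cons !big_nil /=;
  repeat congr (_ :: _); lia.

(** * Computation of the ranks and solution for [r8] to [r14] *)

Theorem theorem2p1 (F : unitRingType) (divF : division_ring F)
  (m p q s t : nat)
  (A : 'M[F]_(m, p)) (B : 'M[F]_(m, q)) (C : 'M[F]_(s, p)) (D : 'M[F]_(t, p))
  (M : 'M[F]_m) (P : 'M[F]_p) (Q : 'M[F]_q) (S : 'M[F]_s) (T : 'M[F]_t)
  (r8 r9 r10 r11 r12 r13 r14 : nat)
  (invM : invertible_mx M) (invP : invertible_mx P) (invQ : invertible_mx Q)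
  (invS : invertible_mx S) (invT : invertible_mx T)
  (sizes_a : nonneg_sizes (Sa_rows A B) /\ nonneg_sizes (Sa_cols A B))
  (sizes_b : nonneg_sizes (Sb_rows B) /\ nonneg_sizes (Sb_cols B))
  (sizes_c : nonneg_sizes (Sc_rows A B C) /\ nonneg_sizes (Sc_cols A B C))
  (sizes_d : nonneg_sizes (Sd_rows A C D r8 r9 r10 r11 r12 r13 r14) /\
             nonneg_sizes (Sd_cols A B C D r8 r9 r10 r11 r12 r13 r14))
  (eq_a : M *m A *m P = Sa A B)
  (eq_b : M *m B *m Q = Sb B)
  (eq_c : S *m C *m P = Sc A B C)
  (eq_d : T *m D *m P = Sd A B C D r8 r9 r10 r11 r12 r13 r14) :
  let AB := row_mx A B in
  let AC := col_mx A C in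
  let AD := col_mx A D in
  let CD := col_mx C D in
  let ACD := col_mx A (col_mx C D) in
  let AB_C0 := block_mx A B C 0 in
  let AB_D0 := block_mx A B D 0 in
  let AB_C0_D0 := col_mx (row_mx A B)
                 (col_mx (row_mx C 0)
                         (row_mx D 0)) in
  let AA_C0_0D := col_mx (row_mx A A)
                 (col_mx (row_mx C 0)
                         (row_mx 0 D)) in
  let AAB_C00_0D0 := col_mx (row_mx A (row_mx A B))
                    (col_mx (row_mx C (row_mx 0 0))
                            (row_mx 0 (row_mx D 0))) in
  let OAB_AA0_C00_0D0 := col_mx (row_mx 0 (row_mx A B))
                        (col_mx (row_mx A (row_mx A 0))
                        (col_mx (row_mx C (row_mx 0 0))
                                (row_mx 0 (row_mx D 0)))) in
  [/\ r8%:Z = - rk AD - rk AB_C0 + rk OAB_AA0_C00_0D0,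
      r9%:Z = rk AB_C0 + rk AB_D0 - rk OAB_AA0_C00_0D0 + rk A - rk AB,
      r10%:Z = - rk C - rk AB_D0 + rk AAB_C00_0D0,
      r11%:Z = rk C + rk D + rk AB - rk AAB_C00_0D0 &
   [/\ r12%:Z = rk AC + rk AD - rk ACD + rk AB_C0_D0 - rk OAB_AA0_C00_0D0,
       r13%:Z = rk AB_C0 + rk AB_D0 + rk AA_C0_0D - rk AAB_C00_0D0
                - rk OAB_AA0_C00_0D0 &
       r14%:Z = rk CD - rk AB_C0_D0 - rk AA_C0_0D + rk OAB_AA0_C00_0D0]].
Proof.
move=> AB AC AD CD ACD AB_C0 AB_D0 AB_C0_D0 AA_C0_0D AAB_C00_0D0 OAB_AA0_C00_0D0.
(* The definitions are kept as linear relations between ranks, for use by [lia]. *)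
have er1 : r1 A B = rk AB - rk B by [].
have er2 : r2 A B = rk A + rk B - rk AB by [].
have er3 : r3 A C = rk AC - rk A by [].
have er4 : r4 A B C = rk AB_C0 + rk A - rk AB - rk AC by [].
have er5 : r5 A B C = rk C + rk AB - rk AB_C0 by [].
have er6 : r6 A C D = rk ACD - rk AC by [].
have er7 : r7 A C D = rk AD + rk AC - rk A - rk ACD by [].
have etheta : rtheta A B C r10 r13 r14 =
  r1 A B - r5 A B C - r10%:Z - r13%:Z - r14%:Z by [].
have epi : rpi A B C r8 r12 = r2 A B - r4 A B C - r8%:Z - r12%:Z by [].
move: sizes_a sizes_b sizes_c sizes_d.
rewrite /nonneg_sizes /Sd_rows /Sd_cols /isum !big_cons !big_nil.
cbn [rcons all Sa_rows Sa_cols Sb_rows Sb_cols Sc_rows Sc_cols].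
case=> /and5P[a1 a2 a3 a4 _] /and4P[a5 a6 a7 _].
case=> /and3P[b1 b2 _] /and3P[b3 b4 _].
case=> /and5P[c1 c2 c3 c4 _] /and4P[c5 c6 c7 /and4P[c8 c9 c10 _]].
case=> /and5P[d1 d2 d3 d4] /and4P[d5 d6 d7 /and4P[d8 d9 d10 _]].
move=> /and5P[e1 e2 e3 e4] /and5P[e5 e6 e7 e8] /and5P[e9 e10 e11 e12].
move=> /and5P[e13 e14 e15 e16] /and3P[e17 e18 _].
pose sz := label_size A B C D r8 r9 r10 r11 r12 r13 r14.
(* The size equalities are linear; nonnegativity of the block sizes removes the absolute values. *)
have redA : reduces sz M P A (flatten A_rows) (flatten A_cols)
    (refine_pattern A_rows A_cols [:: (1, 2); (3, 1)]%N).
  have em : m = sumn (map sz (flatten A_rows)) by rewrite /sz; label_lia.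
  have en : p = sumn (map sz (flatten A_cols)) by rewrite /sz; label_lia.
  split=> //; rewrite eq_a; apply: block_id_pattern_mx => //.
    by rewrite /sz; label_lia.
  by rewrite /sz; label_lia.
(* [/=] turns [|rk B|] into this dimension. *)
have eB : rk B = (dimension (left_row_space B))%:Z by [].
have redB : reduces sz M Q B (flatten B_rows) (flatten B_cols)
    (refine_pattern B_rows B_cols [:: (1, 1)]%N).
  have em : m = sumn (map sz (flatten B_rows)) by rewrite /sz; label_lia.
  have en : q = sumn (map sz (flatten B_cols)) by rewrite /sz; label_lia.
  split=> //; rewrite eq_b; apply: block_id_pattern_mx => //.
    by rewrite /sz; label_lia.
  by rewrite /sz; label_lia.
have redC : reduces sz S P C (flatten C_rows) (flatten C_cols)
    (refine_pattern C_rows C_cols [:: (1, 1); (2, 3); (3, 5)]%N).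
  have em : s = sumn (map sz (flatten C_rows)) by rewrite /sz; label_lia.
  have en : p = sumn (map sz (flatten C_cols)) by rewrite /sz; label_lia.
  split=> //; rewrite eq_c; apply: block_id_pattern_mx => //.
    by rewrite /sz; label_lia.
  by rewrite /sz; label_lia.
have redD : reduces sz T P D (flatten D_rows) (flatten D_cols)
    (refine_pattern D_rows D_cols
       [:: (1, 1); (2, 3); (3, 4); (3, 7); (4, 8); (5, 11); (5, 13); (6, 5);
           (6, 14); (7, 15); (8, 10); (9, 17)]%N).
  have em : t = sumn (map sz (flatten D_rows)) by rewrite /sz; label_lia.
  have en : p = sumn (map sz (flatten D_cols)) by rewrite /sz; label_lia.
  split=> //; rewrite eq_d; apply: block_id_pattern_mx => //.
    by rewrite /sz; label_lia.
  by rewrite /sz; label_lia.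
(* The flattened row labels of [A] and [B] are convertible, as are the flattened column labels of
   [A], [C] and [D], so these reductions can be juxtaposed. *)
pose redAB := reduces_row redA redB.
pose redC0 := reduces_row redC (reduces0 redC redB).
pose redD0 := reduces_row redD (reduces0 redD redB).
pose redC00 :=
  reduces_row redC (reduces_row (reduces0 redC redA) (reduces0 redC redB)).
pose red0D0 := reduces_row (reduces0 redD redA) redD0.
(* Only the seven ranks absent from the definitions of [r1] to [r7] are computed. Each list gives
   the pivot labels in elimination order, and the fuel is their number. *)
have rkD : rk D = (sumn (map sz [:: 1; 3; 4; 8; 11; 5; 15; 10; 17]))%N.
  by apply: (rk_reduces divF (fuel := 9) redD); vm_compute.
have rkCD : rk CD = (sumn (map sz
    [:: 1; 2; 4; 8; 9; 11; 5; 15; 16; 3; 4; 11; 5; 10; 17]))%N.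
  by apply: (rk_reduces divF (fuel := 15) (reduces_col redC redD)); vm_compute.
have rkAB_D0 : rk AB_D0 = (sumn (map sz ([:: 4; 8; 9; 10; 11; 12; 19] ++
    iota 1 6 ++ [:: 4; 8; 11; 5; 15; 10; 17])))%N.
  apply: (rk_reduces divF (fuel := 20) (reduces_col redAB redD0)).
  by vm_compute.
have rkAB_C0_D0 : rk AB_C0_D0 = (sumn (map sz ([:: 4; 8; 9; 10; 11; 12; 19] ++
    iota 1 6 ++ [:: 4; 8; 9; 11; 5; 15; 16; 11; 10; 17])))%N.
  apply: (rk_reduces divF (fuel := 23)
            (reduces_col redAB (reduces_col redC0 redD0))).
  by vm_compute.
have rkAA_C0_0D : rk AA_C0_0D = (sumn (map sz ([:: 4; 8; 9; 10; 11; 12] ++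
    iota 1 6 ++ [:: 1; 2; 4; 8; 9; 11; 5; 15; 16; 3; 4; 11; 5; 15; 10; 17])))%N.
  apply: (rk_reduces divF (fuel := 28) (reduces_col (reduces_row redA redA)
            (reduces_col (reduces_row redC (reduces0 redC redA))
               (reduces_row (reduces0 redD redA) redD)))).
  by vm_compute.
have rkAAB_C00_0D0 : rk AAB_C00_0D0 = (sumn (map sz
    ([:: 4; 8; 9; 10; 11; 12; 19] ++ iota 1 6 ++
     [:: 1; 2; 4; 8; 9; 11; 5; 15; 16; 3; 4; 8; 11; 5; 15; 10; 17])))%N.
  apply: (rk_reduces divF (fuel := 30) (reduces_col (reduces_row redA redAB)
            (reduces_col redC00 red0D0))).
  by vm_compute.
have rkOAB : rk OAB_AA0_C00_0D0 = (sumn (map sz ([:: 4; 8; 9; 10; 11; 12; 19] ++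
    iota 1 6 ++ [:: 4; 8; 9; 10; 11; 12] ++ iota 1 6 ++
    [:: 4; 8; 9; 11; 5; 15; 16; 11; 5; 15; 10; 17])))%N.
  apply: (rk_reduces divF (fuel := 37)
            (reduces_col (reduces_row (reduces0 redA redA) redAB)
               (reduces_col
                  (reduces_row redA (reduces_row redA (reduces0 redA redB)))
                  (reduces_col redC00 red0D0)))).
  by vm_compute.
(* The ranks occurring in [r1] to [r7] stay as unknowns; the seven sums of block sizes are linear in
   them and in [r8] to [r14]. *)
move: rkD rkCD rkAB_D0 rkAB_C0_D0 rkAA_C0_0D rkAAB_C00_0D0 rkOAB.
rewrite /sz /label_size /Sd_cols /isum !big_cons big_nil /=.
move=> *; split; [lia..|split; lia].
Qed.
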